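(* For every real number $x$ with $0 < x < \pi/2$, the following two chains of inequalities hold: $$3 - \frac{x^4}{180} < 2 \frac{\sin x}{x} + \frac{x}{\tanh x} < 3 < 2 \frac{x}{\sin x} + \frac{\tanh x}{x} < 3 + \frac{31}{180}x^4$$ and $$3 - \frac{x^2}{2} < \frac{x}{\sin x} + 2 \frac{\tanh x}{x} < 3 < \frac{\sin x}{x} + 2 \frac{x}{\tanh x} < 3 + \frac{x^2}{2}.$$ *)

(* Defs.v *)
From Stdlib Require Export Reals.

(* Main.v *)
Require Import Defs.
From Stdlib Require Import Reals.
From Stdlib Require Import Lra Psatz.
From Coquelicot Require Import Coquelicot.
Open Scope R_scope.

(** The truncations of Lambert's continued fraction
    [tanh x = x / (1 + x^2 / (3 + x^2 / (5 + ...)))] bound [tanh] alternately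
    from above and below, because the numerators [f_n] of the successive errors
    satisfy [f_(n+1)' = x f_n] and [f_n 0 = 0].  With [u = x^2], these bounds on
    [tanh x / x] and the Taylor bounds on [sin x / x] turn every inequality into
    a polynomial one in [u], valid for [0 < u < 301 / 100], and
    [(PI / 2)^2 < 301 / 100]. *)

Lemma pos_of_derive_pos (f f' : R -> R) (x : R) :
  f 0 = 0 -> (forall t, is_derive f t (f' t)) ->
  (forall t, 0 < t -> 0 < f' t) -> 0 < x -> 0 < f x.
Proof.
  intros f0 df f'pos xpos.
  destruct (MVT_cor2 f f' 0 x xpos) as [c [Hc [c0 _]]].
  - intros t _. apply is_derive_Reals, df.
  - assert (0 < f' c * (x - 0)) by (apply Rmult_lt_0_compat; [auto | lra]).
    lra.
Qed.

Lemma cosh_pos (x : R) : 0 < cosh x.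
Proof.
  unfold cosh. pose proof (exp_pos x). pose proof (exp_pos (- x)). lra.
Qed.

(** The chain of error numerators starts here: the derivative is [t * sinh t], so [sinh] itself
    stands below the first of them. *)
Lemma sinh_lt_x_cosh (x : R) : 0 < x -> 0 < x * cosh x - sinh x.
Proof.
  apply (pos_of_derive_pos (fun t => t * cosh t - sinh t) (fun t => t * sinh t)).
  - rewrite sinh_0. ring.
  - intros t. unfold cosh, sinh. auto_derive; [easy | field].
  - intros t Ht.
    apply Rmult_lt_0_compat; [exact Ht |].
    rewrite <- sinh_0. now apply sinh_lt.
Qed.

Lemma lambert1 (x : R) : 0 < x -> 0 < (3 + x ^ 2) * sinh x - 3 * x * cosh x.
Proof.
  apply (pos_of_derive_pos (fun t => (3 + t ^ 2) * sinh t - 3 * t * cosh t)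
           (fun t => t * (t * cosh t - sinh t))).
  - rewrite sinh_0. ring.
  - intros t. unfold cosh, sinh. auto_derive; [easy | field].
  - intros t Ht. apply Rmult_lt_0_compat; [exact Ht |]. now apply sinh_lt_x_cosh.
Qed.

Lemma lambert2 (x : R) : 0 < x ->
  0 < (15 * x + x ^ 3) * cosh x - (15 + 6 * x ^ 2) * sinh x.
Proof.
  apply (pos_of_derive_pos
           (fun t => (15 * t + t ^ 3) * cosh t - (15 + 6 * t ^ 2) * sinh t)
           (fun t => t * ((3 + t ^ 2) * sinh t - 3 * t * cosh t))).
  - rewrite sinh_0. ring.
  - intros t. unfold cosh, sinh. auto_derive; [easy | field].
  - intros t Ht. apply Rmult_lt_0_compat; [exact Ht |]. now apply lambert1.
Qed.

Lemma lambert3 (x : R) : 0 < x ->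
  0 < (105 + 45 * x ^ 2 + x ^ 4) * sinh x - (105 * x + 10 * x ^ 3) * cosh x.
Proof.
  apply (pos_of_derive_pos
           (fun t => (105 + 45 * t ^ 2 + t ^ 4) * sinh t
                     - (105 * t + 10 * t ^ 3) * cosh t)
           (fun t => t * ((15 * t + t ^ 3) * cosh t - (15 + 6 * t ^ 2) * sinh t))).
  - rewrite sinh_0. ring.
  - intros t. unfold cosh, sinh. auto_derive; [easy | field].
  - intros t Ht. apply Rmult_lt_0_compat; [exact Ht |]. now apply lambert2.
Qed.

(** The fourth truncation of the fraction; its error has the numerator of [lambert3] over a positive
    denominator. The upper bound below is the third truncation, with the numerator of [lambert2]. *)
Lemma tanh_div_lower (x : R) : 0 < x ->
  (105 + 10 * x ^ 2) / (105 + 45 * x ^ 2 + x ^ 4) < tanh x / x.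
Proof.
  intros Hx. pose proof (lambert3 x Hx) as H. pose proof (cosh_pos x) as Hc.
  assert (0 < 105 + 45 * x ^ 2 + x ^ 4) by nra.
  apply Rlt_0_minus.
  replace (tanh x / x - _) with
    (((105 + 45 * x ^ 2 + x ^ 4) * sinh x - (105 * x + 10 * x ^ 3) * cosh x)
     / (x * cosh x * (105 + 45 * x ^ 2 + x ^ 4)))
    by (unfold tanh; field; lra).
  apply Rdiv_lt_0_compat; [exact H |].
  now do 2 (apply Rmult_lt_0_compat; [| assumption]).
Qed.

Lemma tanh_div_upper (x : R) : 0 < x ->
  tanh x / x < (15 + x ^ 2) / (15 + 6 * x ^ 2).
Proof.
  intros Hx. pose proof (lambert2 x Hx) as H. pose proof (cosh_pos x) as Hc.
  assert (0 < 15 + 6 * x ^ 2) by nra.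
  apply Rlt_0_minus.
  replace (_ - tanh x / x) with
    (((15 * x + x ^ 3) * cosh x - (15 + 6 * x ^ 2) * sinh x)
     / (x * cosh x * (15 + 6 * x ^ 2)))
    by (unfold tanh; field; lra).
  apply Rdiv_lt_0_compat; [exact H |].
  now do 2 (apply Rmult_lt_0_compat; [| assumption]).
Qed.

Lemma sin_div_bounds (x : R) : 0 < x < PI ->
  1 - x ^ 2 / 6 + x ^ 4 / 120 - x ^ 6 / 5040 <= sin x / x
    <= 1 - x ^ 2 / 6 + x ^ 4 / 120.
Proof.
  intros [Hx HPI].
  (* [sin_bound x n] encloses [sin x] between its Taylor polynomials of degrees [4n + 3] and
     [4n + 5]: degree 7 from below for [n = 1], degree 5 from above for [n = 0]. *)
  destruct (sin_bound x 1 ltac:(lra) ltac:(lra)) as [Hl _].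
  destruct (sin_bound x 0 ltac:(lra) ltac:(lra)) as [_ Hu].
  unfold sin_approx, sin_term in Hl, Hu. simpl in Hl, Hu.
  split.
  - apply Rle_div_r; [exact Hx | nra].
  - apply Rle_div_l; [exact Hx | nra].
Qed.

Lemma PI_half_sqr_lt : (PI / 2) ^ 2 < 301 / 100.
Proof.
  (* Three terms of the Leibniz series suffice: [1 - 1/3 + 1/5 = 13/15], and
     [(26/15)^2 = 676/225 < 3.01]. *)
  destruct (PI_ineq 1) as [_ H].
  unfold tg_alt, PI_tg in H. simpl in H.
  pose proof PI_RGT_0. assert (PI / 4 <= 13 / 15) by lra. nra.
Qed.

(** Here [S = sin x / x], [T = tanh x / x] and [u = x^2]. *)
Lemma wilker_huygens_rational (u S T : R) : 0 < u < 301 / 100 ->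
  1 - u / 6 + u ^ 2 / 120 - u ^ 3 / 5040 <= S <= 1 - u / 6 + u ^ 2 / 120 ->
  (105 + 10 * u) / (105 + 45 * u + u ^ 2) < T < (15 + u) / (15 + 6 * u) ->
  (3 - u ^ 2 / 180 < 2 * S + / T /\ 2 * S + / T < 3 /\
   3 < 2 * / S + T /\ 2 * / S + T < 3 + 31 / 180 * u ^ 2) /\
  (3 - u / 2 < / S + 2 * T /\ / S + 2 * T < 3 /\
   3 < S + 2 * / T /\ S + 2 * / T < 3 + u / 2).
Proof.
  intros [u0 u1] [Sl Su] [Tl Tu].
  (* Comparing consecutive powers of [u] lets [lra], which treats them as independent unknowns,
     settle the polynomial inequalities below. *)
  assert (u2 : 0 < u ^ 2 < 301 / 100 * u) by nra.
  assert (u3 : 0 < u ^ 3 < 301 / 100 * u ^ 2) by nra.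
  assert (u4 : 0 < u ^ 4 < 301 / 100 * u ^ 3) by nra.
  assert (u5 : 0 < u ^ 5 < 301 / 100 * u ^ 4) by nra.
  assert (u6 : 0 < u ^ 6 < 301 / 100 * u ^ 5) by nra.
  set (q := 1 - u / 6 + u ^ 2 / 120) in *.
  set (p := q - u ^ 3 / 5040) in *.
  assert (p0 : 0 < p) by (unfold p, q; lra).
  assert (q0 : 0 < q) by (unfold q; lra).
  assert (d0 : 0 < 105 + 45 * u + u ^ 2) by lra.
  assert (l0 : 0 < (105 + 10 * u) / (105 + 45 * u + u ^ 2))
    by (apply Rdiv_lt_0_compat; lra).
  assert (iSl : / q <= / S) by (apply Rinv_le_contravar; lra).
  assert (iSu : / S <= / p) by (apply Rinv_le_contravar; lra).
  assert (iTl : (15 + 6 * u) / (15 + u) < / T).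
  { replace ((15 + 6 * u) / (15 + u)) with (/ ((15 + u) / (15 + 6 * u))) by (field; lra).
    apply Rinv_lt_contravar; [apply Rmult_lt_0_compat |]; lra. }
  assert (iTu : / T < (105 + 45 * u + u ^ 2) / (105 + 10 * u)).
  { replace ((105 + 45 * u + u ^ 2) / (105 + 10 * u))
      with (/ ((105 + 10 * u) / (105 + 45 * u + u ^ 2))) by (field; lra).
    apply Rinv_lt_contravar; [apply Rmult_lt_0_compat |]; lra. }
  (* These first-order bounds on [T] and [/ S] add up to exactly [3] in [2 * / S + T] and to
     [3 - u / 2] in [/ S + 2 * T]. *)
  assert (Tl' : 1 - u / 3 < T).
  { eapply Rlt_trans; [| exact Tl]. apply Rlt_div_r; [lra |]. lra. }
  assert (iSl' : 1 + u / 6 < / S).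
  { eapply Rlt_le_trans; [| exact iSl]. rewrite <- Rdiv_1_l.
    apply Rlt_div_r; [lra |]. unfold q. lra. }
  (* The series of [x / sin x] in [u], with its cubic coefficient [31/15120] raised to [1/200] to
     absorb the tail. *)
  assert (iSu' : / S < 1 + u / 6 + 7 / 360 * u ^ 2 + u ^ 3 / 200).
  { eapply Rle_lt_trans; [exact iSu |]. rewrite <- Rdiv_1_l.
    apply Rlt_div_l; [lra |]. unfold p, q. lra. }
  repeat split.
  (* Both sides expand as [1 + u/3 - u^2/45]; the cubic coefficients [1/2520] and [1/675] leave the
     room. *)
  - assert (3 - u ^ 2 / 180 - 2 * p < (15 + 6 * u) / (15 + u)); [| lra].
    apply Rlt_div_r; [lra |]. unfold p, q. lra.
  - assert ((105 + 45 * u + u ^ 2) / (105 + 10 * u) < 3 - 2 * q); [| lra].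
    apply Rlt_div_l; [lra |]. unfold q. lra.
  - lra.
  (* The cubic term is chosen to cancel that of twice [iSu']; the quadratic ones give
     [7/180 + 2/15 = 31/180]. *)
  - assert ((15 + u) / (15 + 6 * u) < 1 - u / 3 + 2 / 15 * u ^ 2 - u ^ 3 / 100); [| lra].
    apply Rlt_div_l; [lra |]. lra.
  - lra.
  (* The right side is half of [3] minus the bound of [iSu']. *)
  - assert ((15 + u) / (15 + 6 * u) < 1 - u / 12 - 7 / 720 * u ^ 2 - u ^ 3 / 400); [| lra].
    apply Rlt_div_l; [lra |]. lra.
  - assert (3 / 2 - p / 2 < (15 + 6 * u) / (15 + u)); [| lra].
    apply Rlt_div_r; [lra |]. unfold p, q. lra.
  - assert ((105 + 45 * u + u ^ 2) / (105 + 10 * u) < 3 / 2 + u / 4 - q / 2); [| lra].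
    apply Rlt_div_l; [lra |]. unfold q. lra.
Qed.

Theorem theorem4 : forall x : R, 0 < x < PI / 2 ->
  (3 - x ^ 4 / 180 < 2 * (sin x / x) + x / tanh x /\
   2 * (sin x / x) + x / tanh x < 3 /\
   3 < 2 * (x / sin x) + tanh x / x /\
   2 * (x / sin x) + tanh x / x < 3 + 31 / 180 * x ^ 4) /\
  (3 - x ^ 2 / 2 < x / sin x + 2 * (tanh x / x) /\
   x / sin x + 2 * (tanh x / x) < 3 /\
   3 < sin x / x + 2 * (x / tanh x) /\
   sin x / x + 2 * (x / tanh x) < 3 + x ^ 2 / 2).
Proof.
  intros x [x0 x1]. pose proof PI_half_sqr_lt as HPI.
  assert (Hu : 0 < x ^ 2 < 301 / 100) by nra.
  pose proof (sin_div_bounds x ltac:(lra)) as HS.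
  pose proof (conj (tanh_div_lower x x0) (tanh_div_upper x x0)) as HT.
  replace (x ^ 4) with ((x ^ 2) ^ 2) in * by ring.
  replace (x ^ 6) with ((x ^ 2) ^ 3) in * by ring.
  rewrite <- (Rinv_div (sin x) x), <- (Rinv_div (tanh x) x).
  now apply wilker_huygens_rational.
Qed.
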